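(* Let $F:\mathbb{R}^n\to\mathbb{R}^n$ be $L_F$-Lipschitz, $L_F\in[0,\infty)$. Suppose there is a nonempty set $\mathcal S^\star\subseteq \operatorname{zer}F$ and some $\rho\in(-\tfrac1{2L_F},\infty)$ such that $\langle Fz,z-z^\star\rangle\ge\rho\|Fz\|^2$ for all $z\in\mathbb{R}^n$ and all $z^\star\in\mathcal S^\star$. Let $\hat F(\cdot,\xi):\mathbb{R}^n\to\mathbb{R}^n$, $\xi\sim\mathcal P$, be a stochastic oracle which can be queried at two points under the same $\xi$, and such that for all $z,z'\in\mathbb{R}^n$: $\mathbb E_\xi[\hat F(z,\xi)]=Fz$, $\mathbb E_\xi[\|\hat F(z,\xi)-Fz\|^2]\le\sigma_F^2$, and $\mathbb E_\xi[\|\hat F(z,\xi)-\hat F(z',\xi)\|^2]\le L_{\hat F}^2\|z-z'\|^2$ with $0<L_{\hat F}<\infty$. Suppose that $\gamma\in(\lfloor-2\rho\rfloor_+,1/L_F)$ and that $(\alpha_k)_{k\ge0}\subset(0,1)$ is a diminishing sequence such that $$2\gamma L_{\hat F}\sqrt{\alpha_0}+\Big(1+\big(\tfrac{1+\gamma^2L_F^2}{1-\gamma^2L_F^2}\gamma^2L_F^2\big)\gamma^2L_{\hat F}^2\Big)\alpha_0\le 1+\tfrac{2\rho}{\gamma}.$$ Let $(z^k)$ be generated by BC-SEG+ (see context). Then for all $z^\star\in\mathcal S^\star$ and all integers $K\ge0$, $$\mathbb E[\|F(z^{k_\star})\|^2]\le\frac{(1+\eta\gamma^2L_F^2)\|z^0-z^\star\|^2+C\sigma_F^2\gamma^2\sum_{j=0}^K\alpha_j^2}{\mu\sum_{j=0}^K\alpha_j},$$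 where $C=1+2\eta\big((\gamma^2L_{\hat F}^2+1)+2\alpha_0\big)$, $\eta=\tfrac12\tfrac{1+\gamma^2L_F^2}{1-\gamma^2L_F^2}\gamma^2L_F^2+\tfrac{1}{\gamma L_{\hat F}\sqrt{\alpha_0}}$, $\mu=\gamma^2(1-\gamma^2L_F^2)/2$, and $k_\star$ is chosen from $\{0,1,\dots,K\}$, independently of the algorithm, with probability $\Pr[k_\star=k]=\alpha_k/\sum_{j=0}^K\alpha_j$.
   Context: Norms are Euclidean. $\operatorname{zer}F=\{z: Fz=0\}$, $\lfloor t\rfloor_+=\max\{t,0\}$, and $1/0=+\infty$ in expressions of the form $1/L_F$, $1/(2L_F)$. A diminishing sequence is a nonincreasing sequence converging to $0$. BC-SEG+ (bias-corrected stochastic extragradient+): given $z^0\in\mathbb{R}^n$, set $z^{-1}=\bar z^{-1}=z^0$. For $k=0,1,\dots$: 1. sample $\xi_k\sim\mathcal P$; 2. $\bar z^k=z^k-\gamma\hat F(z^k,\xi_k)+(1-\alpha_k)\big(\bar z^{k-1}-z^{k-1}+\gamma\hat F(z^{k-1},\xi_k)\big)$; 3. sample $\bar\xi_k\sim\mathcal P$; 4. $z^{k+1}=z^k-\alpha_k\gamma\hat F(\bar z^k,\bar\xi_k)$. All samples $\xi_0,\bar\xi_0,\xi_1,\bar\xi_1,\dots$ are mutually independent, and $\hat F$ is measurable. *)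

(* Defs.v *)
From HB Require Import structures.
From mathcomp Require Import all_boot all_order all_algebra.
From mathcomp Require Import finmap.
From mathcomp Require Import all_classical all_reals all_analysis.
Import Order.TTheory GRing.Theory Num.Theory.
Import numFieldNormedType.Exports.

Set Implicit Arguments.
Unset Strict Implicit.
Unset Printing Implicit Defensive.

Local Open Scope classical_set_scope.
Local Open Scope ring_scope.

(* The norm of MathComp-Analysis on matrices is the max norm; the Euclidean
   structure of R^n is given by the following two functions. *)
Definition dotp (R : realType) (n : nat) (u v : 'rV[R]_n) : R :=
  \sum_(i < n) u 0 i * v 0 i.

Definition enorm (R : realType) (n : nat) (u : 'rV[R]_n) : R :=
  Num.sqrt (\sum_(i < n) u 0 i ^+ 2).

Definition zer (R : realType) (n : nat) (F : 'rV[R]_n -> 'rV[R]_n) :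
  set 'rV[R]_n := [set z | F z = 0].

(* R^n carries the product sigma-algebra of the Borel sigma-algebras of its
   coordinates (i.e., the Borel sigma-algebra of R^n), as n.-tuple R does in
   MathComp-Analysis. *)
Section measurable_rV.
Context {R : realType} {n : nat}.

Let coors : 'I_n -> 'rV[R]_n -> R := fun i v => v 0 i.

Let rV_set0 : g_sigma_preimage coors set0.
Proof. exact: sigma_algebra0. Qed.

Let rV_setC A : g_sigma_preimage coors A -> g_sigma_preimage coors (~` A).
Proof. exact: sigma_algebraC. Qed.

Let rV_bigcup (A : (set 'rV[R]_n)^nat) :
  (forall i, g_sigma_preimage coors (A i)) ->
  g_sigma_preimage coors (\bigcup_i A i).
Proof. exact: sigma_algebra_bigcup. Qed.

HB.instance Definition _ :=
  @isMeasurable.Build default_measure_display 'rV[R]_n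
    (g_sigma_preimage coors) rV_set0 rV_setC rV_bigcup.

End measurable_rV.

Section independence.
Context d d' (T : measurableType d) (T' : measurableType d') (R : realType).
Variable P : probability T R.

Definition mutually_independent (I : choiceType) (X : I -> T -> T') : Prop :=
  forall (J : {fset I}) (A : I -> set T'),
    (forall i, i \in J -> measurable (A i)) ->
    P (\bigcap_(i in [set` J]) X i @^-1` A i) =
    (\prod_(i <- J) P (X i @^-1` A i))%E.

(* the sigma-algebra generated by all the X i jointly *)
Definition sigma_family (I : Type) (X : I -> T -> T') : set (set T) :=
  <<s \bigcup_i preimage_set_system setT (X i) measurable >>.

Definition independent_of_family d'' (T'' : measurableType d'')
    (Y : T -> T'') (I : Type) (X : I -> T -> T') : Prop :=
  forall (B : set T'') (E : set T), measurable B -> sigma_family X E ->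
    P (Y @^-1` B `&` E) = (P (Y @^-1` B) * P E)%E.

End independence.

(* The sequences xi and xibar as a single family. *)
Definition samples (A : Type) (xi xibar : nat -> A) (i : nat + nat) : A :=
  match i with inl k => xi k | inr k => xibar k end.

Section bcseg_plus.
Context {R : realType} {n : nat} {Xi : Type}.
Variables (Fhat : 'rV[R]_n -> Xi -> 'rV[R]_n) (gamma : R) (alpha : nat -> R).
Variables (z0 : 'rV[R]_n) (xi xibar : nat -> Xi).

(* The state before iteration k is (z^{k-1}, zbar^{k-1}, z^k). *)
Record bcseg_state := BCSegState {
  bc_zprev : 'rV[R]_n; bc_zbarprev : 'rV[R]_n; bc_z : 'rV[R]_n }.

Definition bcseg_step (k : nat) (s : bcseg_state) : bcseg_state :=
  let: BCSegState zprev zbarprev z := s in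
  let zbar := z - gamma *: Fhat z (xi k)
    + (1 - alpha k) *: (zbarprev - zprev + gamma *: Fhat zprev (xi k)) in
  BCSegState z zbar (z - (alpha k * gamma) *: Fhat zbar (xibar k)).

Fixpoint bcseg_run (k : nat) : bcseg_state :=
  if k is k'.+1 then bcseg_step k' (bcseg_run k') else BCSegState z0 z0 z0.

Definition bcseg_plus (k : nat) : 'rV[R]_n := bc_z (bcseg_run k).

End bcseg_plus.

(* Main.v *)
Require Import Defs.
From HB Require Import structures.
From mathcomp Require Import all_boot all_order all_algebra.
From mathcomp Require Import finmap.
From mathcomp Require Import all_classical all_reals all_analysis.
From mathcomp Require Import measurable_realfun.
From mathcomp Require Import ring lra.
Import Order.TTheory GRing.Theory Num.Theory.
Import numFieldNormedType.Exports.

Set Implicit Arguments.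
Unset Strict Implicit.
Unset Printing Implicit Defensive.

Local Open Scope classical_set_scope.
Local Open Scope ring_scope.

(** The proof runs on a Lyapunov function.  Write

      u^k = zbar^k - z^k + gamma F z^k

    for the bias of the extrapolated point with respect to the exact
    extragradient point z^k - gamma F z^k, and let

      V_k = |z^k - zs|^2 + eta' |u^(k-1)|^2
            + 2 eta' gamma^2 LFhat^2 |z^k - z^(k-1)|^2.

    Averaging over the update sample, <F zbar, z - zs> is split at zbar: the
    weak Minty inequality bounds one part below by rho |F zbar|^2, and in the
    other part z - zbar = gamma F z - u.  Polarizing <F zbar, F z> and using
    that F is Lipschitz with gamma LF < 1 leaves a gain of order
    mu |F z|^2 at the price of a multiple of |u|^2 (descent_inequality).  Young's
    inequality with weight e, applied to <F zbar, u>, costs e |F zbar|^2; this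
    and the second moment of the update are absorbed by the step size
    condition.

    Averaging over the extrapolation sample, u^k is (1 - alpha_k) u^(k-1) plus
    a centered term.  Both points z^k and z^(k-1) are queried under the same
    sample, so the mean-square Lipschitz bound makes that term as small as
    |z^k - z^(k-1)|, which V_k contains, up to alpha_k sigma
    (integral_oracle_correction).  As (1 + 2 alpha)(1 - alpha)^2 <= 1, the
    |u|^2 paid for in the first half is recovered (integral_half_energy).
    Hence E V_(k+1) + alpha_k mu E |F z^k|^2 <= E V_k + O(alpha_k^2)
    (expected_descent), which telescopes; the random index turns the weighted
    sum of the E |F z^k|^2 into the expectation of the theorem
    (expectation_random_index).

    The choice e = gamma LFhat sqrt(alpha_0) minimizes
    e + gamma^2 LFhat^2 alpha_0 / e; this produces the term
    2 gamma LFhat sqrt(alpha_0) of the step size condition.  It corresponds to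
    eta' = (q + 1/e) / 2 with q = (1 + c) c / (1 - c) and c = gamma^2 LF^2,
    which is below eta = q / 2 + 1/e, and the final bound increases with eta.

    No conditional expectation is formed.  The sigma-algebra generated by the
    earlier samples makes the sample space a measurable space of its own, on
    which the current iterate is measurable; a fresh sample is independent of
    that sigma-algebra, so the joint law is a product and Tonelli's theorem
    replaces conditioning (independent_tonelli). *)

(** * The Borel structure of the space of row vectors *)

Lemma measurable_rV_coord (R : realType) (n : nat) (i : 'I_n) :
  measurable_fun [set: 'rV[R]_n] (fun v : 'rV[R]_n => v 0 i).
Proof.
move=> _ Y mY; rewrite setTI; apply: sub_sigma_algebra => /=.
rewrite -bigcup_seq/=; exists i => /=; first by rewrite mem_index_enum.
by exists Y => //; rewrite setTI.
Qed.

Lemma measurable_fun_rVP (d : measure_display) (T : measurableType d)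
    (R : realType) (n : nat) (f : T -> 'rV[R]_n) :
  measurable_fun [set: T] f <->
  forall i, measurable_fun [set: T] (fun x => f x 0 i).
Proof.
split=> [mf i|mf].
  exact: (measurableT_comp (@measurable_rV_coord R n i) mf).
apply: (measurability (\big[setU/set0]_(i < n)
   preimage_set_system setT (fun v : 'rV[R]_n => v 0 i) measurable)).
  by [].
move=> _ [B + <-]; rewrite -bigcup_seq => -[i _ [A mA <-]].
by rewrite setTI [X in measurable X](_ : _ = setT `&` (fun x => f x 0 i) @^-1` A);
  [exact: mf|rewrite !setTI].
Qed.

Lemma measurable_rV_add (d : measure_display) (T : measurableType d)
    (R : realType) (n : nat) (f g : T -> 'rV[R]_n) :
  measurable_fun [set: T] f -> measurable_fun [set: T] g ->
  measurable_fun [set: T] (fun x => f x + g x).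
Proof.
move=> /measurable_fun_rVP mf /measurable_fun_rVP mg.
apply/measurable_fun_rVP => i.
rewrite [X in measurable_fun _ X](_ : _ = fun x => f x 0 i + g x 0 i).
  exact: measurable_funD.
by apply/funext => x; rewrite mxE.
Qed.

Lemma measurable_rV_scale (d : measure_display) (T : measurableType d)
    (R : realType) (n : nat) (a : R) (f : T -> 'rV[R]_n) :
  measurable_fun [set: T] f -> measurable_fun [set: T] (fun x => a *: f x).
Proof.
move=> /measurable_fun_rVP mf; apply/measurable_fun_rVP => i.
rewrite [X in measurable_fun _ X](_ : _ = fun x => a * f x 0 i).
  exact: measurable_funM.
by apply/funext => x; rewrite mxE.
Qed.

Lemma measurable_rV_opp (d : measure_display) (T : measurableType d)
    (R : realType) (n : nat) (f : T -> 'rV[R]_n) :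
  measurable_fun [set: T] f -> measurable_fun [set: T] (fun x => - f x).
Proof.
move=> mf; under eq_fun do rewrite -scaleN1r.
exact: measurable_rV_scale.
Qed.

Lemma enorm_sqr (R : realType) (n : nat) (u : 'rV[R]_n) :
  enorm u ^+ 2 = \sum_(i < n) u 0 i ^+ 2.
Proof. by rewrite sqr_sqrtr// sumr_ge0// => i _; exact: sqr_ge0. Qed.

Lemma measurable_enorm_sqr (d : measure_display) (T : measurableType d)
    (R : realType) (n : nat) (f : T -> 'rV[R]_n) :
  measurable_fun [set: T] f ->
  measurable_fun [set: T] (fun x => enorm (f x) ^+ 2).
Proof.
move=> /measurable_fun_rVP mf; under eq_fun do rewrite enorm_sqr.
by apply: measurable_sum => i; exact: measurable_funX.
Qed.

(** * Euclidean identities *)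

Section euclidean.
Context {R : realType} {n : nat}.
Implicit Types u v w : 'rV[R]_n.

Lemma dotpC u v : dotp u v = dotp v u.
Proof. by apply: eq_bigr => i _; rewrite mulrC. Qed.

Lemma dotpDl u v w : dotp (u + v) w = dotp u w + dotp v w.
Proof. by rewrite -big_split; apply: eq_bigr => i _; rewrite mxE mulrDl. Qed.

Lemma dotpZl (a : R) u v : dotp (a *: u) v = a * dotp u v.
Proof. by rewrite mulr_sumr; apply: eq_bigr => i _; rewrite mxE mulrA. Qed.

Lemma dotpDr u v w : dotp u (v + w) = dotp u v + dotp u w.
Proof. by rewrite dotpC dotpDl !(dotpC _ u). Qed.

Lemma dotpZr (a : R) u v : dotp u (a *: v) = a * dotp u v.
Proof. by rewrite dotpC dotpZl dotpC. Qed.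

Lemma dotpNl u v : dotp (- u) v = - dotp u v.
Proof. by rewrite -scaleN1r dotpZl mulN1r. Qed.

Lemma dotpNr u v : dotp u (- v) = - dotp u v.
Proof. by rewrite dotpC dotpNl dotpC. Qed.

Lemma enorm_sqr_dotp u : enorm u ^+ 2 = dotp u u.
Proof. by rewrite enorm_sqr; apply: eq_bigr => i _; rewrite expr2. Qed.

Lemma dotp_ge0 u : 0 <= dotp u u.
Proof. by rewrite -enorm_sqr_dotp sqr_ge0. Qed.

Definition dotpE := (dotpDl, dotpDr, dotpNl, dotpNr, dotpZl, dotpZr).

Lemma enorm_sqrD u v :
  enorm (u + v) ^+ 2 = enorm u ^+ 2 + 2 * dotp u v + enorm v ^+ 2.
Proof. by rewrite !enorm_sqr_dotp !dotpE (dotpC v u); ring. Qed.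

Lemma enorm_sqrZ (a : R) u : enorm (a *: u) ^+ 2 = a ^+ 2 * enorm u ^+ 2.
Proof. by rewrite !enorm_sqr_dotp !dotpE; ring. Qed.

Lemma enorm_sqrD_le u v :
  enorm (u + v) ^+ 2 <= 2 * enorm u ^+ 2 + 2 * enorm v ^+ 2.
Proof.
have := dotp_ge0 (u - v); rewrite !enorm_sqr_dotp !dotpE (dotpC v u); lra.
Qed.

Lemma enorm0_sqr : enorm (0 : 'rV[R]_n) ^+ 2 = 0.
Proof. by rewrite -(scale0r 0) enorm_sqrZ expr0n mul0r. Qed.

Lemma enorm_ge0 u : 0 <= enorm u. Proof. exact: sqrtr_ge0. Qed.

End euclidean.

(** * Second moments of centered random vectors *)

Section centered.
Context {d : measure_display} {V : measurableType d} {R : realType} {n : nat}.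
Variable Q : probability V R.
Implicit Types X Y : V -> 'rV[R]_n.

Lemma integral_probability_cst (r : R) : (\int[Q]_x r%:E = r%:E)%E.
Proof. by have := expectation_cst Q r; rewrite unlock. Qed.

(** Stated in this shape because both halves of an iteration average a square
    plus a multiple of another square plus a term free of the sample. *)
Lemma integral_affine (f g : V -> R) (b c : R) :
  measurable_fun setT f -> measurable_fun setT g ->
  (forall x, 0 <= f x) -> (forall x, 0 <= g x) -> 0 <= b -> 0 <= c ->
  (\int[Q]_x (f x + b * g x + c)%:E =
   \int[Q]_x (f x)%:E + b%:E * \int[Q]_x (g x)%:E + c%:E)%E.
Proof.
move=> /measurable_EFinP mf /measurable_EFinP mg f0 g0 b0 c0.
under eq_integral do rewrite !EFinD EFinM.
have ef0 x : setT x -> (0 <= (f x)%:E)%E by rewrite lee_fin.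
have eg0 x : setT x -> (0 <= (g x)%:E)%E by rewrite lee_fin.
have mbg : measurable_fun setT (fun x => (b%:E * (g x)%:E)%E).
  exact: measurable_funeM.
have ebg0 x : setT x -> (0 <= b%:E * (g x)%:E)%E.
  by move=> _; rewrite -EFinM lee_fin mulr_ge0.
rewrite ge0_integralD//=; [|by move=> x _; rewrite adde_ge0 ?ef0 ?ebg0
  |exact: emeasurable_funD].
rewrite integral_probability_cst ge0_integralD//.
by rewrite ge0_integralZl_EFin.
Qed.

(** The finite second moment makes the mean meaningful: it implies that each
    coordinate is integrable. *)
Definition centered X := [/\ measurable_fun setT X,
  (forall i, \int[Q]_x (X x 0 i)%:E = 0)%E &
  (\int[Q]_x (enorm (X x) ^+ 2)%:E < +oo)%E].

Lemma measurable_enorm_sqrE X : measurable_fun setT X ->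
  measurable_fun setT (fun x => (enorm (X x) ^+ 2)%:E).
Proof. by move=> mX; apply/measurable_EFinP; exact: measurable_enorm_sqr. Qed.

Lemma integrable_enorm_sqr X : measurable_fun setT X ->
  (\int[Q]_x (enorm (X x) ^+ 2)%:E < +oo)%E ->
  Q.-integrable setT (fun x => (enorm (X x) ^+ 2)%:E).
Proof.
move=> mX X2; apply/integrableP; split; first exact: measurable_enorm_sqrE.
by under eq_integral do rewrite gee0_abs ?lee_fin ?sqr_ge0//.
Qed.

Lemma integrable_coord X i : measurable_fun setT X ->
  (\int[Q]_x (enorm (X x) ^+ 2)%:E < +oo)%E ->
  Q.-integrable setT (fun x => (X x 0 i)%:E).
Proof.
move=> mX X2.
have mXi : measurable_fun setT (fun x => (X x 0 i)%:E).
  by apply/measurable_EFinP; move/measurable_fun_rVP: mX.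
(* |t| <= 1 + t^2, and constants are integrable for a probability *)
apply: (@le_integrable _ _ _ Q setT measurableT _
  ((EFin \o cst 1%R) \+ (fun x => (enorm (X x) ^+ 2)%:E))%E) => //.
  move=> x _ /=; rewrite lee_fin [leRHS]ger0_norm ?addr_ge0 ?sqr_ge0//.
  have xi_le : X x 0 i ^+ 2 <= enorm (X x) ^+ 2.
    rewrite enorm_sqr (bigD1 i)//= lerDl sumr_ge0// => j _; exact: sqr_ge0.
  have := sqr_ge0 (`|X x 0 i| - 1); rewrite sqrrB1 real_normK ?num_real//.
  have := normr_ge0 (X x 0 i); lra.
apply: integrableD => //; last exact: integrable_enorm_sqr.
exact: finite_measure_integrable_cst.
Qed.

Lemma centered_dotp X w : centered X ->
  Q.-integrable setT (fun x => (dotp w (X x))%:E) /\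
  (\int[Q]_x (dotp w (X x))%:E = 0)%E.
Proof.
move=> [mX EX X2].
have E x : ((dotp w (X x))%:E = \sum_(i < n) (w 0 i)%:E * (X x 0 i)%:E)%E.
  by rewrite sumEFin.
have iX i : Q.-integrable setT (fun x => ((w 0 i)%:E * (X x 0 i)%:E)%E).
  by apply: integrableZl => //; exact: integrable_coord.
rewrite (funext E); split; first exact: integrable_sum.
rewrite integral_sum// big1// => i _.
by rewrite integralZl//; [rewrite EX mule0|exact: integrable_coord].
Qed.

(** Pythagoras: the cross term has mean zero. *)
Lemma integral_enorm_sqrD X w : centered X ->
  (\int[Q]_x (enorm (w + X x) ^+ 2)%:E =
   (enorm w ^+ 2)%:E + \int[Q]_x (enorm (X x) ^+ 2)%:E)%E.
Proof.
move=> cX; have [iw ew] := centered_dotp w cX; case: cX => mX EX X2.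
under eq_integral do rewrite enorm_sqrD -addrA EFinD EFinD (EFinM 2).
have ic : Q.-integrable setT (fun=> (enorm w ^+ 2)%:E).
  exact: finite_measure_integrable_cst.
have i2 := integrable_enorm_sqr mX X2.
have i1 : Q.-integrable setT (fun x => (2%:E * (dotp w (X x))%:E)%E).
  exact: integrableZl.
rewrite integralD//; last exact: integrableD.
rewrite integralD// integralZl// ew mule0 add0e.
by rewrite integral_probability_cst.
Qed.

Lemma integral_enorm_sqr_lincomb X Y (a b : R) :
  measurable_fun setT X -> measurable_fun setT Y ->
  (\int[Q]_x (enorm (a *: X x + b *: Y x) ^+ 2)%:E <=
   (2 * a ^+ 2)%:E * \int[Q]_x (enorm (X x) ^+ 2)%:E +
   (2 * b ^+ 2)%:E * \int[Q]_x (enorm (Y x) ^+ 2)%:E)%E.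
Proof.
move=> mX mY.
have c0 (c : R) : 0 <= 2 * c ^+ 2 by rewrite mulr_ge0 ?sqr_ge0.
have mX2 := measurable_enorm_sqrE mX; have mY2 := measurable_enorm_sqrE mY.
rewrite -!ge0_integralZl//; do ?by move=> *; rewrite lee_fin ?c0 ?sqr_ge0.
rewrite -ge0_integralD//; last 4 first.
- by move=> x _; rewrite -EFinM lee_fin mulr_ge0 ?sqr_ge0.
- exact: measurable_funeM.
- by move=> x _; rewrite -EFinM lee_fin mulr_ge0 ?sqr_ge0.
- exact: measurable_funeM.
apply: ge0_le_integral => //.
- by move=> x _; rewrite lee_fin sqr_ge0.
- by apply: measurable_enorm_sqrE; apply: measurable_rV_add;
    exact: measurable_rV_scale.
- by apply: emeasurable_funD; exact: measurable_funeM.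
- move=> x _; rewrite -!EFinM -EFinD lee_fin.
  by rewrite (le_trans (enorm_sqrD_le _ _))// !enorm_sqrZ !mulrA.
Qed.

Lemma centered_lincomb X Y (a b : R) : centered X -> centered Y ->
  centered (fun x => a *: X x + b *: Y x).
Proof.
move=> [mX EX X2] [mY EY Y2]; split.
- by apply: measurable_rV_add; exact: measurable_rV_scale.
- move=> i; under eq_integral do rewrite !mxE EFinD !EFinM.
  have iX := integrable_coord i mX X2; have iY := integrable_coord i mY Y2.
  rewrite integralD//; [|exact: integrableZl..].
  by rewrite !integralZl// EX EY !mule0 adde0.
- apply: le_lt_trans (integral_enorm_sqr_lincomb a b mX mY) _.
  by apply: lte_add_pinfty; apply: lte_mul_pinfty => //;
    rewrite lee_fin mulr_ge0 ?sqr_ge0.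
Qed.

End centered.

(** * Independence and iterated integrals *)

(** The intersections of finitely many preimages under the X (h j) form a
    pi-system generating the sigma-algebra of the family.  On it, the measures
    E |-> P (Y in B, E) and E |-> P (Y in B) P E, with Y = X i0, agree by mutual
    independence, hence they agree on the whole sigma-algebra. *)
Lemma mutually_independent_of_family (d d' : measure_display)
    (T : measurableType d) (T' : measurableType d') (R : realType)
    (P : probability T R) (I : choiceType) (X : I -> T -> T')
    (J : Type) (h : J -> I) (i0 : I) :
  (forall i, measurable_fun setT (X i)) ->
  mutually_independent P X -> (forall j, h j <> i0) ->
  independent_of_family P (X i0) (fun j => X (h j)).
Proof.
move=> mX indep hi0 B E mB sE.
have mXA i A : measurable A -> measurable (X i @^-1` A).
  by move=> mA; rewrite -(setTI (_ @^-1` _)); exact: mX.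
pose C := [set E : set T | exists (S : {fset I}) (A : I -> set T'),
  [/\ i0 \notin S, (forall i, measurable (A i)) &
    E = \bigcap_(i in [set` S]) X i @^-1` A i]].
have Cm : C `<=` measurable.
  move=> _ [S [A [_ mA ->]]].
  by apply: fin_bigcap_measurable => // i _; exact: mXA.
have CT : C setT.
  exists fset0, (fun=> setT); split=> //.
  by apply/seteqP; split=> // x _ i /=; rewrite inE.
have CI : setI_closed C.
  move=> _ _ [S [A [nS mA ->]]] [S' [A' [nS' mA' ->]]].
  exists (S `|` S')%fset, (fun i => (if i \in S then A i else setT) `&`
    (if i \in S' then A' i else setT)); split.
  - by rewrite inE negb_or nS.
  - by move=> i; apply: measurableI; case: ifP.
  - apply/seteqP; split=> [x [Sx S'x] i /= iS|x SS'x].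
      by split; case: ifPn => // ?; [exact: Sx|exact: S'x].
    split=> i /= iS.
      by have := SS'x i; rewrite /= inE iS => /(_ isT)[].
    by have := SS'x i; rewrite /= inE iS orbT => /(_ isT)[].
have PB : P (X i0 @^-1` B) \is a fin_num by rewrite fin_num_measure//; exact: mXA.
have fB0 : 0 <= fine (P (X i0 @^-1` B)) by rewrite fine_ge0.
have := @g_sigma_algebra_measure_unique _ R T C Cm (fun=> setT) (fun=> CT) _
  (mrestr P (mXA i0 B mB)) (mscale (NngNum fB0) P) CI.
rewrite /mrestr/= => /(_ _ _ _ E).
rewrite /mscale/= fineK// setIC; apply.
- by rewrite bigcup_const.
- move=> _ [S [A [nS mA ->]]].
  pose A' i := if i == i0 then B else A i.
  have mA' i : measurable (A' i) by rewrite /A'; case: ifP.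
  have bigE : \bigcap_(i in [set` S]) X i @^-1` A i =
              \bigcap_(i in [set` S]) X i @^-1` A' i.
    apply: eq_bigcapr => i /= iS; rewrite /A'; case: eqP => // ii0.
    by rewrite -ii0 iS in nS.
  have := indep (i0 |` S)%fset A' (fun i _ => mA' i).
  rewrite big_fsetU1//= {2}/A' eqxx -(indep S A' (fun i _ => mA' i)) bigE => <-.
  congr (P _); apply/seteqP; split=> [x [Sx Bx] i|x H].
    by rewrite /= !inE => /orP[/eqP ->|/Sx//]; rewrite /A' eqxx.
  split=> [i iS|]; first by apply: H; rewrite /= !inE (_ : i \in S) ?orbT.
  by have := H i0; rewrite /= !inE eqxx /A' eqxx => /(_ isT).
- by move=> _; rewrite ltey_eq fin_num_measure.

- apply: sE; split; first exact: smallest_sigma_algebra.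
  move=> _ [j _ [A mA <-]]; rewrite setTI; apply: sub_sigma_algebra.
  exists [fset h j]%fset, (fun=> A); split=> //.
    by rewrite inE; apply/eqP => /esym; exact: hi0.
  apply/seteqP; split=> [x Ax i /=|x H]; last by apply: H; rewrite /= inE.
  by rewrite inE => /eqP ->.
Qed.

(** Generators of the sigma-algebra of the events determined by the family X;
    family_space X is the sample space with that coarser sigma-algebra, so that
    measurability there means being a function of the family. *)
Definition family_preimages (T : Type) (d' : measure_display)
    (T' : measurableType d') (I : Type) (X : I -> T -> T') : set (set T) :=
  \bigcup_i preimage_set_system setT (X i) measurable.

Notation family_space X := (g_sigma_algebraType (family_preimages X)).

Lemma measurable_fun_family_space (T : pointedType) (d' : measure_display)
    (T' : measurableType d') (I : Type) (X : I -> T -> T') (i : I) :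
  measurable_fun setT (X i : family_space X -> T').
Proof. by move=> _ A mA; apply: sub_sigma_algebra; exists i => //; exists A. Qed.

Lemma sub_family_space (d d' : measure_display) (T : measurableType d)
    (T' : measurableType d') (I : Type) (X : I -> T -> T') :
  (forall i, measurable_fun setT (X i)) ->
  @measurable _ (family_space X) `<=` @measurable _ T.
Proof.
move=> mX A sA; apply: sA; split; first exact: sigma_algebra_measurable.
by move=> _ [i _ [B mB <-]]; exact: mX.
Qed.

(** By independence the law of w |-> (w, Y w), its first component seen in the
    coarser space, is a product measure: averaging a function of the family and
    of Y is averaging over a fresh copy of Y. *)
Lemma independent_tonelli (d d' d'' : measure_display)
    (T : measurableType d) (T' : measurableType d') (V : measurableType d'')
    (R : realType) (P : probability T R) (Q : probability V R)
    (I : Type) (X : I -> T -> T') (Y : T -> V)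
    (g : family_space X * V -> \bar R) :
  (forall i, measurable_fun setT (X i)) -> measurable_fun setT Y ->
  (forall B, measurable B -> P (Y @^-1` B) = Q B) ->
  independent_of_family P Y X ->
  measurable_fun setT g -> (forall p, 0 <= g p)%E ->
  (\int[P]_w g (w, Y w) = \int[P]_w \int[Q]_y g (w, y))%E.
Proof.
move=> mX mY lawY indep mg g0.
have mid : measurable_fun setT (id : T -> family_space X).
  by move=> _ A sA; rewrite setTI preimage_id; exact: (sub_family_space mX).
pose S : {mfun T >-> family_space X} := HB.pack (id : T -> family_space X)
  (isMeasurableFun.Build _ _ _ _ _ mid).
have mSY : measurable_fun setT (fun w : T => (S w, Y w)).
  exact: measurable_fun_pair.
pose SY : {mfun T >-> (family_space X * V)%type} :=
  HB.pack (fun w : T => (S w, Y w)) (isMeasurableFun.Build _ _ _ _ _ mSY).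
have prodE := @product_measure_unique _ _ _ _ R (distribution P S) Q
  (distribution P SY).
rewrite -(@ge0_integral_distribution _ _ _ _ _ P SY g mg g0).
transitivity (\int[(distribution P S \x Q)%E]_p g p)%E.
  apply: eq_measure_integral => A mA _; apply/esym/prodE => // {mA} {}A B mA mB.
  have -> : (distribution P S A * Q B = P A * P (Y @^-1` B))%E by rewrite lawY.
  by rewrite muleC -indep// setIC.
rewrite fubini_tonelli1// ge0_integral_distribution//.
  exact: measurable_fun_fubini_tonelli_F.
by move=> w; apply: integral_ge0 => y _; exact: g0.
Qed.

(** The form used for conditional bounds: h majorizes the average over Y when the
    family is frozen at w. *)
Lemma independent_tonelli_le (d d' d'' : measure_display)
    (T : measurableType d) (T' : measurableType d') (V : measurableType d'')
    (R : realType) (P : probability T R) (Q : probability V R)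
    (I : Type) (X : I -> T -> T') (Y : T -> V)
    (g : family_space X * V -> \bar R) (h : T -> \bar R) :
  (forall i, measurable_fun setT (X i)) -> measurable_fun setT Y ->
  (forall B, measurable B -> P (Y @^-1` B) = Q B) ->
  independent_of_family P Y X ->
  measurable_fun setT g -> (forall p, 0 <= g p)%E ->
  measurable_fun setT h -> (forall w, \int[Q]_y g (w, y) <= h w)%E ->
  (\int[P]_w g (w, Y w) <= \int[P]_w h w)%E.
Proof.
move=> mX mY lawY indep mg g0 mh gh.
rewrite (independent_tonelli mX mY lawY indep mg g0).
apply: ge0_le_integral => //.
- by move=> w _; apply: integral_ge0.
- have := @measurable_fun_fubini_tonelli_F _ _ (family_space X) V R Q g mg g0.
  move=> mF _ A mA; apply: (sub_family_space mX).
  exact: mF.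
Qed.

(** Split according to the value of the index, and use that each event
    Y = k is independent of the family. *)
Lemma expectation_random_index (d d' : measure_display)
    (T : measurableType d) (T' : measurableType d') (R : realType)
    (P : probability T R) (I : Type) (X : I -> T -> T')
    (f : nat -> family_space X -> R) (Y : {RV P >-> nat}) (K : nat) :
  (forall i, measurable_fun setT (X i)) ->
  independent_of_family P Y X -> (forall w, (Y w <= K)%N) ->
  (forall k, measurable_fun setT (f k)) -> (forall k w, 0 <= f k w) ->
  (\int[P]_w (f (Y w) w)%:E =
   \sum_(0 <= k < K.+1) P (Y @^-1` [set k]) * \int[P]_w (f k w)%:E)%E.
Proof.
move=> mX indep YK mf f0.
have fT k : measurable_fun setT (f k : T -> R).
  by move=> _ A mA; apply: (sub_family_space mX); exact: mf.
have m1 (k : nat) : measurable_fun setT (\1_[set k] : nat -> R).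
  exact: measurable_indic.
have mY k : measurable_fun setT (fun w => \1_[set k] (Y w) : R).
  exact: (measurableT_comp (m1 k) (measurable_funP Y)).
transitivity (\int[P]_w (\sum_(0 <= k < K.+1) (\1_[set k] (Y w) * f k w)%:E))%E.
  apply: eq_integral => w _.
  have memY : Y w \in index_iota 0 K.+1 by rewrite mem_index_iota /= ltnS YK.
  rewrite (bigD1_seq (Y w) memY (iota_uniq _ _))/=.
  rewrite big1 ?adde0 => [|k kY]; first by rewrite indicE mem_set// mul1r.
  rewrite indicE memNset ?mul0r//= => Ywk.
  by rewrite Ywk eqxx in kY.
rewrite ge0_integral_sum//; last 2 first.
- by move=> k; apply/measurable_EFinP; exact: measurable_funM.
- by move=> k w _; rewrite lee_fin mulr_ge0.
apply: eq_bigr => k _.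
pose g (q : family_space X * nat) := (\1_[set k] q.2 * f k q.1)%:E.
rewrite (independent_tonelli (Q := distribution P Y) (g := g) mX _ _ indep)//.
- under eq_integral => w _.
    under eq_integral do rewrite /g /= EFinM muleC.
    rewrite ge0_integralZl//; last by rewrite lee_fin.
    rewrite integral_indic// setIT muleC.
    over.
  rewrite ge0_integralZl//.
    exact/measurable_EFinP.
  by move=> w _; rewrite lee_fin.
- apply/measurable_EFinP; apply: measurable_funM.
    exact: (measurableT_comp (m1 k) measurable_snd).
  exact: (measurableT_comp (mf k) measurable_fst).
- by move=> q; rewrite lee_fin mulr_ge0.
Qed.

(** * The deterministic descent inequality *)

(** Young's inequality with the weight for which the coefficient of |v|^2 is
    (1 + c) / 2, so that a gain |v|^2 keeps the fraction (1 - c) / 2; the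
    difference of the two sides is |2 c u + (1 - c) v|^2 / (2 (1 - c)). *)
Lemma weighted_young_le (R : realType) (n : nat) (u v : 'rV[R]_n) (c : R) :
  0 <= c < 1 ->
  c * enorm (u - v) ^+ 2 <=
  (1 + c) / (1 - c) * c * enorm u ^+ 2 + (1 + c) / 2 * enorm v ^+ 2.
Proof.
move=> /andP[c0 c1]; have c1' : 0 < 1 - c by rewrite subr_gt0.
have := dotp_ge0 ((2 * c) *: u + (1 - c) *: v).
rewrite !enorm_sqr_dotp !dotpE (dotpC v u) => H.
rewrite -subr_ge0.
set X := dotp u u in H *; set Y := dotp u v in H *; set Z := dotp v v in H *.
rewrite (_ : _ - _ = (2 * c * (2 * c * X) + (1 - c) * (2 * c * Y) +
  (2 * c * ((1 - c) * Y) + (1 - c) * ((1 - c) * Z))) / (2 * (1 - c))).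
  by apply: divr_ge0; [lra|lra].
by field; lra.
Qed.

(** One update with the exact operator.  The term B |alpha gamma F zb|^2 is the
    share of the Lyapunov function that measures the next displacement; the
    hypothesis on e + alpha (1 + B) makes the total coefficient of |F zb|^2
    nonpositive. *)
Lemma descent_inequality (R : realType) (n : nat)
    (F : 'rV[R]_n -> 'rV[R]_n) (LF rho gamma alpha eta e B : R)
    (z zb zs : 'rV[R]_n) :
  (forall z z', enorm (F z - F z') <= LF * enorm (z - z')) ->
  rho * enorm (F zb) ^+ 2 <= dotp (F zb) (zb - zs) ->
  0 < gamma -> gamma ^+ 2 * LF ^+ 2 < 1 -> 0 <= alpha -> 0 < e ->
  2 * eta = (1 + gamma ^+ 2 * LF ^+ 2) / (1 - gamma ^+ 2 * LF ^+ 2)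
            * (gamma ^+ 2 * LF ^+ 2) + e^-1 ->
  e + alpha * (1 + B) <= 1 + 2 * rho / gamma ->
  enorm (z - zs - (alpha * gamma) *: F zb) ^+ 2
    + B * enorm ((alpha * gamma) *: F zb) ^+ 2
    + alpha * (gamma ^+ 2 * (1 - gamma ^+ 2 * LF ^+ 2) / 2) * enorm (F z) ^+ 2
  <= enorm (z - zs) ^+ 2
     + 2 * alpha * eta * enorm (zb - z + gamma *: F z) ^+ 2.
Proof.
move=> F_lip wminty g0 c1 a0 e0 etaE cond.
set u := zb - z + gamma *: F z; set f := F z; set g := F zb.
have zbE : zb - z = u - gamma *: f by rewrite /u addrK.
clearbody u.
have c01 : 0 <= gamma ^+ 2 * LF ^+ 2 < 1 by rewrite c1 mulr_ge0 ?sqr_ge0.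
have lip2 : enorm (g - f) ^+ 2 <= LF ^+ 2 * enorm (u - gamma *: f) ^+ 2.
  have LF0 := le_trans (enorm_ge0 _) (F_lip zb z).
  by rewrite -zbE -exprMn ler_sqr ?nnegrE ?enorm_ge0// F_lip.
have y1 := weighted_young_le u (gamma *: f) c01.
(* Young's inequality with weight e, from |e gamma g - u|^2 >= 0 *)
have y2 : 2 * gamma * dotp g u <= e * gamma ^+ 2 * dotp g g + e^-1 * dotp u u.
  have := dotp_ge0 ((e * gamma) *: g - u); rewrite !dotpE (dotpC u g) => H.
  rewrite -subr_ge0 (_ : _ - _ = (e * gamma * (e * gamma * dotp g g)
    + e * gamma * - dotp g u - (e * gamma * dotp g u + - dotp u u)) / e).
    by apply: divr_ge0; lra.
  by field; lra.
have wm : dotp g (z - zs) = dotp g (zb - zs) + gamma * dotp g f - dotp g u.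
  rewrite (_ : z - zs = (zb - zs) + (gamma *: f - u)).
    by rewrite !dotpE; ring.
  by rewrite -[gamma *: f - u]opprB -zbE opprB [RHS]addrC addrA subrK.
have pol : enorm (g - f) ^+ 2 = dotp g g - 2 * dotp g f + dotp f f.
  by rewrite enorm_sqr_dotp !dotpE (dotpC f g); ring.
rewrite pol in lip2.
rewrite -/g enorm_sqr_dotp in wminty.
have -> : enorm (z - zs - (alpha * gamma) *: g) ^+ 2 = enorm (z - zs) ^+ 2
   - 2 * alpha * gamma * dotp g (z - zs) + alpha ^+ 2 * gamma ^+ 2 * dotp g g.
  rewrite !enorm_sqr_dotp; move: (z - zs) => v.
  by rewrite !dotpE (dotpC v g); ring.
rewrite enorm_sqrZ wm.
move: y1 lip2; rewrite enorm_sqrZ.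
rewrite (enorm_sqr_dotp u) (enorm_sqr_dotp f) (enorm_sqr_dotp g).
have G0 := dotp_ge0 g.
set c := gamma ^+ 2 * LF ^+ 2 in c1 c01 etaE *.
set q := (1 + c) / (1 - c) * c in etaE *.
move=> y1 lip2.
set D := enorm _ ^+ 2 in y1 lip2; set S := enorm _ ^+ 2.
have lip3 : gamma ^+ 2 * (dotp g g - 2 * dotp g f + dotp f f) <= c * D.
  by rewrite /c -mulrA ler_wpM2l ?sqr_ge0.
(* proved without the factor alpha, which may be 0, then multiplied by it *)
have key : - 2 * gamma * (dotp g (zb - zs) + gamma * dotp g f - dotp g u)
   + gamma ^+ 2 * (1 + B) * alpha * dotp g g
   + gamma ^+ 2 * (1 - c) / 2 * dotp f f <= 2 * eta * dotp u u.
  have h1 : gamma * (rho * dotp g g) <= gamma * dotp g (zb - zs).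
    by rewrite ler_wpM2l// ltW.
  have h2 : gamma ^+ 2 * (e + alpha * (1 + B)) * dotp g g <=
            (gamma ^+ 2 + 2 * rho * gamma) * dotp g g.
    rewrite ler_wpM2r//.
    rewrite (_ : _ + 2 * rho * gamma = gamma ^+ 2 * (1 + 2 * rho / gamma)).
      by rewrite ler_wpM2l ?sqr_ge0.
    by field; lra.
  rewrite etaE.
  lra.
have := ler_wpM2l a0 key.
lra.
Qed.

(** * Analysis of one iteration *)

Lemma measurable_fun_integral (d d' : measure_display) (U : measurableType d)
    (V : measurableType d') (R : realType) (Q : probability V R)
    (f : U * V -> \bar R) :
  measurable_fun setT f -> measurable_fun setT (fun u => (\int[Q]_v f (u, v))%E).
Proof.
move=> mf; under eq_fun => u do
  rewrite integralE -[fun v => f (u, v)]/(f \o pair u) funepos_comp funeneg_comp.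
apply: emeasurable_funB.
- exact: (@measurable_fun_fubini_tonelli_F _ _ U V R Q f^\+%E
    (measurable_funepos mf) (funepos_ge0 f)).
- exact: (@measurable_fun_fubini_tonelli_F _ _ U V R Q f^\-%E
    (measurable_funeneg mf) (funeneg_ge0 f)).
Qed.

Lemma bcseg_stepE (R : realType) (n : nat) (Xi : Type)
    (Fhat : 'rV[R]_n -> Xi -> 'rV[R]_n) (gamma : R) (alpha : nat -> R)
    (xi xibar : nat -> Xi) (k : nat) (s : bcseg_state) :
  bcseg_step Fhat gamma alpha xi xibar k s =
  let zbar := bc_z s - gamma *: Fhat (bc_z s) (xi k)
    + (1 - alpha k) *: (bc_zbarprev s - bc_zprev s
                        + gamma *: Fhat (bc_zprev s) (xi k)) in
  BCSegState (bc_z s) zbar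
    (bc_z s - (alpha k * gamma) *: Fhat zbar (xibar k)).
Proof. by case: s. Qed.

Section bcseg_analysis.
Context {R : realType} {n : nat} {d : measure_display} {V : measurableType d}.
Variables (Q : probability V R) (F : 'rV[R]_n -> 'rV[R]_n).
Variable Fhat : 'rV[R]_n -> V -> 'rV[R]_n.
Variables sigma L : R.
Hypothesis Fhat_meas :
  measurable_fun [set: 'rV[R]_n * V] (fun p => Fhat p.1 p.2).
Hypothesis Fhat_mean :
  forall z (i : 'I_n), (\int[Q]_x (Fhat z x 0 i)%:E = (F z 0 i)%:E)%E.
Hypothesis Fhat_var : forall z,
  (\int[Q]_x (enorm (Fhat z x - F z) ^+ 2)%:E <= (sigma ^+ 2)%:E)%E.
Hypothesis Fhat_lip : forall z z',
  (\int[Q]_x (enorm (Fhat z x - Fhat z' x) ^+ 2)%:E <=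
   (L ^+ 2 * enorm (z - z') ^+ 2)%:E)%E.

Let noise z x := Fhat z x - F z.

Lemma measurable_oracle (d' : measure_display) (T : measurableType d')
    (z : T -> 'rV[R]_n) (x : T -> V) :
  measurable_fun setT z -> measurable_fun setT x ->
  measurable_fun setT (fun w => Fhat (z w) (x w)).
Proof.
move=> mz mx; exact: (measurableT_comp Fhat_meas (measurable_fun_pair mz mx)).
Qed.

(** F inherits measurability from the oracle, being its mean: an integral with
    respect to one variable is measurable in the other. *)
Lemma measurable_oracle_mean : measurable_fun setT F.
Proof.
apply/measurable_fun_rVP => i; apply/measurable_EFinP.
rewrite [X in measurable_fun _ X](_ : _ =
    fun z => (\int[Q]_x (Fhat z x 0 i)%:E)%E); last first.
  by apply/funext => z /=; rewrite Fhat_mean.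
apply: (@measurable_fun_integral _ _ _ _ R Q (fun p => (Fhat p.1 p.2 0 i)%:E)).
by apply/measurable_EFinP; move/measurable_fun_rVP : Fhat_meas.
Qed.

(** Integrability of the oracle itself follows from that of the noise, which has
    a finite second moment. *)
Lemma centered_noise z : centered Q (noise z).
Proof.
have mz : measurable_fun setT (noise z).
  by apply: measurable_rV_add; [exact: measurable_oracle|exact: measurable_cst].
have v : (\int[Q]_x (enorm (noise z x) ^+ 2)%:E < +oo)%E.
  by rewrite (le_lt_trans (Fhat_var z))// ltry.
split=> // i.
have ic : Q.-integrable setT (fun=> (F z 0 i)%:E).
  exact: finite_measure_integrable_cst.
have in_ := integrable_coord i mz v.
have := Fhat_mean z i.
rewrite (_ : (fun x => (Fhat z x 0 i)%:E) =
  (fun x => (noise z x 0 i)%:E + (F z 0 i)%:E)%E); last first.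
  by apply/funext => x; rewrite -EFinD !mxE subrK.
rewrite integralD// integral_probability_cst.
have fi := integrable_fin_num measurableT in_.
by rewrite -(fineK fi) -EFinD => -[]; rewrite -[RHS]add0r => /addIr ->.
Qed.

(** A variance is at most the second moment. *)
Lemma integral_noise_diff z z' :
  (\int[Q]_x (enorm (1 *: noise z x + -1 *: noise z' x) ^+ 2)%:E <=
   (L ^+ 2 * enorm (z - z') ^+ 2)%:E)%E.
Proof.
apply: le_trans (Fhat_lip z z').
have cX := centered_lincomb 1 (-1) (centered_noise z) (centered_noise z').
have := integral_enorm_sqrD (F z - F z') cX.
rewrite (_ : (fun x => _) = (fun x => (enorm (Fhat z x - Fhat z' x) ^+ 2)%:E));
  last first.
  apply/funext => x; congr ((enorm _ ^+ 2)%:E).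
  by apply/rowP => i; rewrite !mxE; ring.
by move=> ->; rewrite leeDr// lee_fin sqr_ge0.
Qed.

Lemma integral_oracle_step (w : 'rV[R]_n) (a : R) z :
  (\int[Q]_y (enorm (w - a *: Fhat z y) ^+ 2)%:E <=
   (enorm (w - a *: F z) ^+ 2 + a ^+ 2 * sigma ^+ 2)%:E)%E.
Proof.
have [mX EX X2] := centered_noise z.
have cX := centered_lincomb (- a) 0 (centered_noise z) (centered_noise z).
have := integral_enorm_sqrD (w - a *: F z) cX.
rewrite (_ : (fun x => _) = (fun x => (enorm (w - a *: Fhat z x) ^+ 2)%:E));
  last first.
  apply/funext => x; congr ((enorm _ ^+ 2)%:E).
  by apply/rowP => i; rewrite !mxE; ring.
move=> ->; rewrite EFinD leeD2l//.
under eq_integral do rewrite scale0r addr0 enorm_sqrZ sqrrN EFinM.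
have mE := measurable_enorm_sqrE mX.
rewrite ge0_integralZl//; do ?by move=> *; rewrite lee_fin sqr_ge0.
rewrite (EFinM (a ^+ 2)) lee_wpmul2l ?lee_fin ?sqr_ge0//.
exact: Fhat_var.
Qed.

(** The bias after an extrapolation step: w is the contracted old bias.  Grouping
    the noise as (1 - a) (noise zp - noise z) - a noise z isolates a part that is
    small with z - zp and a part that is small with a. *)
Lemma integral_oracle_correction (w zp z : 'rV[R]_n) (a g : R) :
  (\int[Q]_x (enorm (w + ((1 - a) * g) *: (Fhat zp x - F zp)
     - g *: (Fhat z x - F z)) ^+ 2)%:E <=
   (enorm w ^+ 2 + 2 * ((1 - a) * g) ^+ 2 * (L ^+ 2 * enorm (z - zp) ^+ 2)
     + 2 * (a * g) ^+ 2 * sigma ^+ 2)%:E)%E.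
Proof.
have cD := centered_lincomb 1 (-1) (centered_noise z) (centered_noise zp).
have cX := centered_lincomb (- ((1 - a) * g)) (- (a * g)) cD (centered_noise z).
have := integral_enorm_sqrD w cX.
rewrite (_ : (fun x => _) = (fun x => (enorm (w + ((1 - a) * g) *:
    (Fhat zp x - F zp) - g *: (Fhat z x - F z)) ^+ 2)%:E)); last first.
  apply/funext => x; congr ((enorm _ ^+ 2)%:E).
  by apply/rowP => i; rewrite !mxE; ring.
move=> ->; rewrite -addrA EFinD leeD2l//.
have [mD _ _] := cD; have [mz _ _] := centered_noise z.
apply: le_trans (integral_enorm_sqr_lincomb _ _ _ mD mz) _.
rewrite !sqrrN EFinD.
have c0 (c : R) : (0 <= (2 * c ^+ 2)%:E)%E by rewrite lee_fin mulr_ge0 ?sqr_ge0.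
apply: leeD; rewrite (EFinM (2 * _)) lee_wpmul2l//; last exact: Fhat_var.
exact: integral_noise_diff.
Qed.

(** Here e is the weight of Young's inequality in the descent inequality, and eta
    is half of the resulting coefficient of the squared bias. *)
Variables LF rho gamma eta e : R.
Variable zs : 'rV[R]_n.
Hypothesis F_lip : forall z z', enorm (F z - F z') <= LF * enorm (z - z').
Hypothesis weak_minty : forall z,
  rho * enorm (F z) ^+ 2 <= dotp (F z) (z - zs).
Hypothesis gamma_gt0 : 0 < gamma.
Hypothesis gammaLF_lt1 : gamma ^+ 2 * LF ^+ 2 < 1.
Hypothesis e_gt0 : 0 < e.
Hypothesis etaE : 2 * eta =
  (1 + gamma ^+ 2 * LF ^+ 2) / (1 - gamma ^+ 2 * LF ^+ 2)
    * (gamma ^+ 2 * LF ^+ 2) + e^-1.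

Let B := 2 * eta * (gamma ^+ 2 * L ^+ 2).
Let mu := gamma ^+ 2 * (1 - gamma ^+ 2 * LF ^+ 2) / 2.

(** At the state before iteration k this is V_k: bias of the last extrapolation
    and last displacement are carried along, since the next bias depends on
    them. *)
Definition lyapunov (s : @bcseg_state R n) : R :=
  enorm (bc_z s - zs) ^+ 2
  + eta * enorm (bc_zbarprev s - bc_zprev s + gamma *: F (bc_zprev s)) ^+ 2
  + B * enorm (bc_z s - bc_zprev s) ^+ 2.

(** The point zbar of the algorithm, as a function of the sample to average
    over. *)
Definition extrapolation (a : R) (s : @bcseg_state R n) (x : V) : 'rV[R]_n :=
  bc_z s - gamma *: Fhat (bc_z s) x
  + (1 - a) *: (bc_zbarprev s - bc_zprev s + gamma *: Fhat (bc_zprev s) x).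

(** An upper bound for the mean of V_(k+1) once the extrapolation sample is
    drawn.  The coefficient eta (1 + 2 a) adds to eta the share 2 a eta charged by
    the descent inequality; the last summand is the variance of the update, counted
    in the distance and in the displacement. *)
Definition half_energy (a : R) (s : @bcseg_state R n) (x : V) : R :=
  enorm (bc_z s - zs) ^+ 2
  + eta * (1 + 2 * a)
    * enorm (extrapolation a s x - bc_z s + gamma *: F (bc_z s)) ^+ 2
  + (1 + B) * ((a * gamma) ^+ 2 * sigma ^+ 2).

Lemma eta_gt0 : 0 < eta.
Proof.
have c0 : 0 <= gamma ^+ 2 * LF ^+ 2 by rewrite mulr_ge0 ?sqr_ge0.
suff: 0 < 2 * eta by rewrite pmulr_rgt0.
rewrite etaE ltr_wpDl ?invr_gt0// mulr_ge0// divr_ge0 ?subr_ge0 ?ltW//.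
by rewrite ltr_pwDl.
Qed.

Let mu_ge0 : 0 <= mu.
Proof. by rewrite divr_ge0// mulr_ge0 ?sqr_ge0// subr_ge0 ltW. Qed.

Let B_ge0 : 0 <= B.
Proof. by apply: mulr_ge0; rewrite mulr_ge0 ?sqr_ge0// ltW// eta_gt0. Qed.

Lemma lyapunov_ge0 s : 0 <= lyapunov s.
Proof.
have eta0 := ltW eta_gt0.
by rewrite /lyapunov !addr_ge0 ?sqr_ge0// mulr_ge0 ?sqr_ge0.
Qed.

Lemma half_energy_ge0 a s x : 0 <= a -> 0 <= half_energy a s x.
Proof.
move=> a0; have eta0 := ltW eta_gt0.
have a1 : 0 <= 1 + 2 * a by rewrite addr_ge0// mulr_ge0.
have B1 : 0 <= 1 + B by rewrite addr_ge0.
rewrite /half_energy !addr_ge0 ?sqr_ge0//; last first.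
  by rewrite mulr_ge0// mulr_ge0 ?sqr_ge0.
by rewrite mulr_ge0 ?sqr_ge0// mulr_ge0.
Qed.

Lemma measurable_extrapolation (d' : measure_display) (T : measurableType d')
    a (s : T -> @bcseg_state R n) (x : T -> V) :
  measurable_fun setT (fun w => bc_zprev (s w)) ->
  measurable_fun setT (fun w => bc_zbarprev (s w)) ->
  measurable_fun setT (fun w => bc_z (s w)) ->
  measurable_fun setT x ->
  measurable_fun setT (fun w => extrapolation a (s w) (x w)).
Proof.
move=> m1 m2 m3 mx; apply: measurable_rV_add.
  apply: measurable_rV_add => //; apply: measurable_rV_opp.
  by apply: measurable_rV_scale; exact: measurable_oracle.
apply: measurable_rV_scale; apply: measurable_rV_add.
  by apply: measurable_rV_add => //; exact: measurable_rV_opp.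
by apply: measurable_rV_scale; exact: measurable_oracle.
Qed.

Lemma measurable_lyapunov (d' : measure_display) (T : measurableType d')
    (s : T -> @bcseg_state R n) :
  measurable_fun setT (fun w => bc_zprev (s w)) ->
  measurable_fun setT (fun w => bc_zbarprev (s w)) ->
  measurable_fun setT (fun w => bc_z (s w)) ->
  measurable_fun setT (fun w => lyapunov (s w)).
Proof.
move=> m1 m2 m3.
have mFz := measurableT_comp measurable_oracle_mean m1.
apply: measurable_funD; first apply: measurable_funD.
- apply: measurable_enorm_sqr; apply: measurable_rV_add => //.
- apply: measurable_funM => //; apply: measurable_enorm_sqr.
  apply: measurable_rV_add; last exact: measurable_rV_scale.
  by apply: measurable_rV_add => //; exact: measurable_rV_opp.
- apply: measurable_funM => //; apply: measurable_enorm_sqr.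
  by apply: measurable_rV_add => //; exact: measurable_rV_opp.
Qed.

Lemma measurable_half_energy (d' : measure_display) (T : measurableType d')
    a (s : T -> @bcseg_state R n) (x : T -> V) :
  measurable_fun setT (fun w => bc_zprev (s w)) ->
  measurable_fun setT (fun w => bc_zbarprev (s w)) ->
  measurable_fun setT (fun w => bc_z (s w)) ->
  measurable_fun setT x ->
  measurable_fun setT (fun w => half_energy a (s w) (x w)).
Proof.
move=> m1 m2 m3 mx.
have mFz := measurableT_comp measurable_oracle_mean m3.
apply: measurable_funD => //; apply: measurable_funD.
- apply: measurable_enorm_sqr; apply: measurable_rV_add => //.
- apply: measurable_funM => //; apply: measurable_enorm_sqr.
  apply: measurable_rV_add; last exact: measurable_rV_scale.
  apply: measurable_rV_add; last exact: measurable_rV_opp.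
  exact: measurable_extrapolation.
Qed.

Lemma integral_update (alpha : nat -> R) (k : nat) s x :
  0 <= alpha k -> e + alpha k * (1 + B) <= 1 + 2 * rho / gamma ->
  (\int[Q]_y (lyapunov (bcseg_step Fhat gamma alpha (fun=> x) (fun=> y) k s)
     + alpha k * mu * enorm (F (bc_z s)) ^+ 2)%:E
   <= (half_energy (alpha k) s x)%:E)%E.
Proof.
set a := alpha k => a0 cond.
set z := bc_z s; set zb := extrapolation a s x.
pose c := eta * enorm (zb - z + gamma *: F z) ^+ 2
  + a * mu * enorm (F z) ^+ 2.
have mu0 := mu_ge0.
have c0 : 0 <= c.
  have eta0 := ltW eta_gt0.
  by rewrite addr_ge0// mulr_ge0 ?sqr_ge0// mulr_ge0.
have mFhat : measurable_fun setT (Fhat zb).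
  exact: measurable_oracle.
have mstep w : measurable_fun setT
    (fun y => enorm (w - (a * gamma) *: Fhat zb y) ^+ 2).
  apply: measurable_enorm_sqr; apply: measurable_rV_add => //.
  by apply: measurable_rV_opp; exact: measurable_rV_scale.
rewrite (_ : (fun y => _) = fun y =>
    (enorm (z - zs - (a * gamma) *: Fhat zb y) ^+ 2
     + B * enorm (0 - (a * gamma) *: Fhat zb y) ^+ 2 + c)%:E); last first.
  apply/funext => y; rewrite bcseg_stepE /lyapunov /=; congr (_%:E).
  rewrite -/a -/z -/(extrapolation a s x) -/zb.
  rewrite (addrAC z _ (- zs)) (addrAC z _ (- z)) subrr /c; ring.
rewrite integral_affine//; do ?by move=> *; exact: sqr_ge0.
have sq0 : 0 <= (a * gamma) ^+ 2 * sigma ^+ 2 by rewrite mulr_ge0 ?sqr_ge0.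
have H1 := integral_oracle_step (z - zs) (a * gamma) zb.
have H2 := integral_oracle_step 0 (a * gamma) zb.
apply: (le_trans (leeD2r _ (leeD H1 (lee_wpmul2l _ H2)))).
  by rewrite lee_fin.
rewrite -EFinM -!EFinD lee_fin /half_energy -/z -/zb /c.
have := @descent_inequality _ _ F LF rho gamma a eta e B z zb zs F_lip
  (weak_minty zb) gamma_gt0 gammaLF_lt1 a0 e_gt0 etaE cond.
have -> : enorm (0 - (a * gamma) *: F zb) ^+ 2 =
          enorm ((a * gamma) *: F zb) ^+ 2.
  by rewrite sub0r -scaleNr !enorm_sqrZ sqrrN.
rewrite -/mu; lra.
Qed.

Lemma integral_half_energy (a : R) s :
  0 <= a <= 1 ->
  (\int[Q]_x (half_energy a s x)%:E <=
   (lyapunov s + (1 + 2 * eta * (gamma ^+ 2 * L ^+ 2 + 1 + 2 * a))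
                 * sigma ^+ 2 * gamma ^+ 2 * a ^+ 2)%:E)%E.
Proof.
move=> /andP[a0 a1].
have eta0 := ltW eta_gt0.
set zp := bc_zprev s; set z := bc_z s.
pose up := bc_zbarprev s - zp + gamma *: F zp.
pose u x := (1 - a) *: up + ((1 - a) * gamma) *: (Fhat zp x - F zp)
  - gamma *: (Fhat z x - F z).
pose c2 := enorm (z - zs) ^+ 2 + (1 + B) * ((a * gamma) ^+ 2 * sigma ^+ 2).
have B1 : 0 <= 1 + B by rewrite addr_ge0.
have a2 : 0 <= eta * (1 + 2 * a) by rewrite mulr_ge0// addr_ge0// mulr_ge0.
have c20 : 0 <= c2 by rewrite addr_ge0 ?sqr_ge0// mulr_ge0// mulr_ge0 ?sqr_ge0.
have mun : measurable_fun setT (fun x => enorm (u x) ^+ 2).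
  apply: measurable_enorm_sqr; apply: measurable_rV_add.
    apply: measurable_rV_add => //; apply: measurable_rV_scale.
    by apply: measurable_rV_add => //; exact: measurable_oracle.
  apply: measurable_rV_opp; apply: measurable_rV_scale.
  by apply: measurable_rV_add => //; exact: measurable_oracle.
rewrite (_ : (fun x => _) = fun x => (0 + eta * (1 + 2 * a) * enorm (u x) ^+ 2
    + c2)%:E); last first.
  apply/funext => x; congr (_%:E); rewrite /half_energy.
  rewrite (_ : extrapolation a s x - bc_z s + gamma *: F (bc_z s) = u x).
    by rewrite /c2 -/z; ring.
  by apply/rowP => i; rewrite !mxE; ring.
rewrite (@integral_affine _ _ _ Q (fun=> 0))//; last by move=> x; exact: sqr_ge0.
rewrite integral0 add0e.
have := integral_oracle_correction ((1 - a) *: up) zp z a gamma.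
move=> /(lee_wpmul2l (x := (eta * (1 + 2 * a))%:E)) H.
apply: (le_trans (leeD2r _ (H _))); first by rewrite lee_fin.
rewrite -EFinM -EFinD lee_fin /c2 /lyapunov -/zp -/z -/up enorm_sqrZ.
(* contraction of the bias outweighs the charge of the descent inequality *)
have h : (1 + 2 * a) * (1 - a) ^+ 2 <= 1.
  rewrite -subr_ge0 (_ : _ - _ = a ^+ 2 * (1 + 2 * (1 - a))); last by ring.
  by rewrite mulr_ge0 ?sqr_ge0// addr_ge0// mulr_ge0// subr_ge0.
set U := enorm up ^+ 2; set D := enorm (z - zp) ^+ 2.
have h1 : (1 + 2 * a) * (1 - a) ^+ 2 * (eta * U) <= eta * U.
  by rewrite ler_piMl// mulr_ge0// sqr_ge0.
have h2 : (1 + 2 * a) * (1 - a) ^+ 2 * (B * D) <= B * D.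
  by rewrite ler_piMl// mulr_ge0// sqr_ge0.
rewrite /B in h2 *.
lra.
Qed.

(** The initial bias is gamma F z0, because zbar and z start equal. *)
Lemma lyapunov_init z0 : F zs = 0 ->
  lyapunov (BCSegState z0 z0 z0) <=
  (1 + eta * gamma ^+ 2 * LF ^+ 2) * enorm (z0 - zs) ^+ 2.
Proof.
move=> Fzs; rewrite /lyapunov /= subrr add0r enorm0_sqr mulr0 addr0.
rewrite mulrDl mul1r lerD2l -(mulrA eta) -(mulrA eta).
rewrite ler_wpM2l ?(ltW eta_gt0)// enorm_sqrZ -(mulrA (gamma ^+ 2)).
rewrite ler_wpM2l ?sqr_ge0// -[F z0]subr0 -Fzs -exprMn.
have := F_lip z0 zs; have := enorm_ge0 (F z0 - F zs).
by move=> h1 h2; rewrite ler_sqr// nnegrE// (le_trans h1 h2).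
Qed.

Lemma measurable_bcseg_step (d' : measure_display) (T : measurableType d')
    (alpha : nat -> R) (k : nat) (s : T -> @bcseg_state R n)
    (x y : nat -> T -> V) :
  measurable_fun setT (fun w => bc_zprev (s w)) ->
  measurable_fun setT (fun w => bc_zbarprev (s w)) ->
  measurable_fun setT (fun w => bc_z (s w)) ->
  measurable_fun setT (x k) -> measurable_fun setT (y k) ->
  let s' w := bcseg_step Fhat gamma alpha (x ^~ w) (y ^~ w) k (s w) in
  [/\ measurable_fun setT (fun w => bc_zprev (s' w)),
      measurable_fun setT (fun w => bc_zbarprev (s' w)) &
      measurable_fun setT (fun w => bc_z (s' w))].
Proof.
move=> m1 m2 m3 mx my s'.
have mbar := measurable_extrapolation (alpha k) m1 m2 m3 mx.
have -> : s' = fun w => let zbar := extrapolation (alpha k) (s w) (x k w) in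
    BCSegState (bc_z (s w)) zbar
      (bc_z (s w) - (alpha k * gamma) *: Fhat zbar (y k w)).
  by apply/funext => w; rewrite /s' bcseg_stepE.
split=> //=; apply: measurable_rV_add => //; apply: measurable_rV_opp.
by apply: measurable_rV_scale; exact: measurable_oracle.
Qed.

Lemma measurable_bcseg_run (d' : measure_display) (Om : measurableType d')
    (alpha : nat -> R) (z0 : 'rV[R]_n) (xi xibar : nat -> Om -> V) (k : nat) :
  (forall j, (j < k)%N -> measurable_fun setT (xi j)) ->
  (forall j, (j < k)%N -> measurable_fun setT (xibar j)) ->
  let s w := bcseg_run Fhat gamma alpha z0 (xi ^~ w) (xibar ^~ w) k in
  [/\ measurable_fun setT (fun w => bc_zprev (s w)),
      measurable_fun setT (fun w => bc_zbarprev (s w)) &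
      measurable_fun setT (fun w => bc_z (s w))].
Proof.
elim: k => [|k IH] mxi mxibar s.
  by split; exact: measurable_cst.
have [||m1 m2 m3] := IH.
- by move=> j jk; apply: mxi; exact: ltnW.
- by move=> j jk; apply: mxibar; exact: ltnW.
exact: (measurable_bcseg_step alpha m1 m2 m3 (mxi k (ltnSn k))
  (mxibar k (ltnSn k))).
Qed.

(** * Expectations along the trajectory *)

Variable alpha : nat -> R.
Hypothesis alpha01 : forall k, 0 <= alpha k <= 1.
Hypothesis alpha_le0 : forall k, alpha k <= alpha 0%N.

Let C := 1 + 2 * eta * (gamma ^+ 2 * L ^+ 2 + 1 + 2 * alpha 0%N).

Hypothesis alpha_cond :
  e + alpha 0%N * (1 + B) <= 1 + 2 * rho / gamma.

Context {d' : measure_display} {T : measurableType d'}.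
Variables (P : probability T R) (xi xibar : nat -> {RV P >-> V}).
Hypothesis xi_law : forall k A, measurable A -> P (xi k @^-1` A) = Q A.
Hypothesis xibar_law : forall k A, measurable A -> P (xibar k @^-1` A) = Q A.
Hypothesis samples_indep :
  mutually_independent P (fun i w => samples xi xibar i w).
Variable z0 : 'rV[R]_n.

Let state k w := bcseg_run Fhat gamma alpha z0 (xi ^~ w) (xibar ^~ w) k.

Let mX i : measurable_fun setT (fun w => samples xi xibar i w).
Proof. by case: i => k; exact: measurable_funP. Qed.

Let mstate k := @measurable_bcseg_run _ T alpha z0
  (fun j => xi j) (fun j => xibar j) k
  (fun j _ => measurable_funP (xi j)) (fun j _ => measurable_funP (xibar j)).

(** The samples are drawn in the order xi 0, xibar 0, xi 1, xibar 1, and so on: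
    the past of xibar k contains xi k, on which zbar^k depends. *)
Definition past_of_xi (k : nat) (i : nat + nat) : bool :=
  match i with inl j | inr j => (j < k)%N end.

Definition past_of_xibar (k : nat) (i : nat + nat) : bool :=
  match i with inl j => (j <= k)%N | inr j => (j < k)%N end.

Let past (p : pred (nat + nat)) (i : {i | p i}) (w : T) : V :=
  samples xi xibar (sval i) w.

Let past_xi (p : pred (nat + nat)) j : p (inl j) ->
  measurable_fun setT (xi j : family_space (@past p) -> V).
Proof.
exact: (fun pj => @measurable_fun_family_space T _ V _ (@past p)
  (exist _ (inl j) pj)).
Qed.

Let past_xibar (p : pred (nat + nat)) j : p (inr j) ->
  measurable_fun setT (xibar j : family_space (@past p) -> V).
Proof.
exact: (fun pj => @measurable_fun_family_space T _ V _ (@past p)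
  (exist _ (inr j) pj)).
Qed.

Let past_indep (p : pred (nat + nat)) i0 : ~~ p i0 ->
  independent_of_family P (fun w => samples xi xibar i0 w) (@past p).
Proof.
move=> pi0; apply: (@mutually_independent_of_family _ _ _ _ _ _ _ _ _ _ i0 mX) => //.
by move=> [i pi] /= ii0; rewrite -ii0 pi in pi0.
Qed.

(** Averages over xibar k, with xi k among the frozen samples. *)
Lemma expected_update k :
  (\int[P]_w (lyapunov (state k.+1 w)
     + alpha k * mu * enorm (F (bc_z (state k w))) ^+ 2)%:E <=
   \int[P]_w (half_energy (alpha k) (state k w) (xi k w))%:E)%E.
Proof.
have [a0 a1] := andP (alpha01 k).
have eta0 := ltW eta_gt0.
have mu0 := mu_ge0.
have B0 := B_ge0.
have cond : e + alpha k * (1 + B) <= 1 + 2 * rho / gamma.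
  by apply: le_trans alpha_cond; rewrite lerD2l ler_wpM2r// addr_ge0.
pose p := past_of_xibar k.
pose stepP (q : family_space (@past p) * V) :=
  bcseg_step Fhat gamma alpha (fun=> xi k q.1) (fun=> q.2) k (state k q.1).
pose g (q : family_space (@past p) * V) :=
  (lyapunov (stepP q) + alpha k * mu * enorm (F (bc_z (state k q.1))) ^+ 2)%:E.
rewrite [leLHS](_ : _ = \int[P]_w g (w, xibar k w))%E; last first.
  by apply: eq_integral => w _; rewrite /g /stepP bcseg_stepE /= bcseg_stepE.
have [m1 m2 m3] := @measurable_bcseg_run _
  (family_space (@past p) * V)%type alpha z0
  (fun j q => xi j q.1) (fun j q => xibar j q.1) k
  (fun j jk => measurableT_comp (past_xi (p := p) (ltnW jk)) measurable_fst)
  (fun j jk => measurableT_comp (past_xibar (p := p) jk) measurable_fst).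
have mxi : measurable_fun setT (fun q : family_space (@past p) * V =>
    xi k q.1).
  exact: (measurableT_comp (past_xi (p := p) (leqnn k)) measurable_fst).
apply: (independent_tonelli_le (Q := Q)) => //.
- exact: xibar_law.
- by apply: (@past_indep p (inr k)); rewrite /p /= ltnn.
- have [m1' m2' m3'] := @measurable_bcseg_step _
    (family_space (@past p) * V)%type alpha k (fun q => state k q.1)
    (fun _ q => xi k q.1) (fun _ q => q.2) m1 m2 m3 mxi measurable_snd.
  apply/measurable_EFinP; apply: measurable_funD.
    exact: measurable_lyapunov.
  apply: measurable_funM => //; apply: measurable_enorm_sqr.
  exact: (measurableT_comp measurable_oracle_mean m3).
- move=> q; rewrite lee_fin addr_ge0//; first exact: lyapunov_ge0.
  by apply: mulr_ge0; [exact: mulr_ge0|exact: sqr_ge0].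
- have [m1' m2' m3'] := mstate k.
  by apply/measurable_EFinP; exact: measurable_half_energy.
- by move=> w; exact: (integral_update (state k w) (xi k w) a0 cond).
Qed.

Lemma expected_half_energy k :
  (\int[P]_w (half_energy (alpha k) (state k w) (xi k w))%:E <=
   \int[P]_w (lyapunov (state k w)
              + C * sigma ^+ 2 * gamma ^+ 2 * alpha k ^+ 2)%:E)%E.
Proof.
have [a0 a1] := andP (alpha01 k).
have eta0 := ltW eta_gt0.
pose p := past_of_xi k.
pose g (q : family_space (@past p) * V) :=
  (half_energy (alpha k) (state k q.1) q.2)%:E.
rewrite [leLHS](_ : _ = \int[P]_w g (w, xi k w))%E//.
have [m1 m2 m3] := @measurable_bcseg_run _
  (family_space (@past p) * V)%type alpha z0
  (fun j q => xi j q.1) (fun j q => xibar j q.1) k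
  (fun j jk => measurableT_comp (past_xi (p := p) jk) measurable_fst)
  (fun j jk => measurableT_comp (past_xibar (p := p) jk) measurable_fst).
apply: (independent_tonelli_le (Q := Q)) => //.
- exact: xi_law.
- by apply: (@past_indep p (inl k)); rewrite /p /= ltnn.
- by apply/measurable_EFinP; exact: measurable_half_energy.
- by move=> q; rewrite lee_fin half_energy_ge0.
- have [m1' m2' m3'] := mstate k.
  apply/measurable_EFinP; apply: measurable_funD => //.
  exact: measurable_lyapunov.
- move=> w; rewrite /g /=.
  apply: (le_trans (integral_half_energy (state k w) (alpha01 k))).
  rewrite lee_fin lerD2l ler_wpM2r ?sqr_ge0// ler_wpM2r ?sqr_ge0//.
  rewrite ler_wpM2r ?sqr_ge0// lerD2l ler_wpM2l ?mulr_ge0// lerD2l.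
  by rewrite ler_wpM2l.
Qed.

Lemma expected_descent k :
  (\int[P]_w (lyapunov (state k.+1 w))%:E
   + (alpha k * mu)%:E * \int[P]_w (enorm (F (bc_z (state k w))) ^+ 2)%:E <=
   \int[P]_w (lyapunov (state k w))%:E
   + (C * sigma ^+ 2 * gamma ^+ 2 * alpha k ^+ 2)%:E)%E.
Proof.
have [a0 a1] := andP (alpha01 k).
have eta0 := ltW eta_gt0.
have mu0 := mu_ge0.
have ml j : measurable_fun setT (fun w => lyapunov (state j w)).
  by have [m1 m2 m3] := mstate j; exact: measurable_lyapunov.
have := le_trans (expected_update k) (expected_half_energy k).
have [m1 m2 m3] := mstate k.
have mFz : measurable_fun setT (fun w => enorm (F (bc_z (state k w))) ^+ 2).
  apply: measurable_enorm_sqr.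
  exact: (measurableT_comp measurable_oracle_mean m3).
have C0 : 0 <= C * sigma ^+ 2 * gamma ^+ 2 * alpha k ^+ 2.
  rewrite mulr_ge0 ?sqr_ge0// mulr_ge0 ?sqr_ge0// mulr_ge0 ?sqr_ge0//.
  have [aa0 _] := andP (alpha01 0%N).
  rewrite /C addr_ge0// mulr_ge0 ?mulr_ge0// addr_ge0 ?mulr_ge0//.
  by rewrite addr_ge0// mulr_ge0 ?sqr_ge0.
(* both integrands are put in the shape f + b g + c of integral_affine *)
have -> : (fun w => (lyapunov (state k.+1 w) + alpha k * mu
    * enorm (F (bc_z (state k w))) ^+ 2)%:E) =
  (fun w => (lyapunov (state k.+1 w) + alpha k * mu
    * enorm (F (bc_z (state k w))) ^+ 2 + 0)%:E).
  by apply/funext => w; rewrite addr0.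
have -> : (fun w => (lyapunov (state k w)
    + C * sigma ^+ 2 * gamma ^+ 2 * alpha k ^+ 2)%:E) =
  (fun w => (lyapunov (state k w) + 0 * lyapunov (state k w)
    + C * sigma ^+ 2 * gamma ^+ 2 * alpha k ^+ 2)%:E).
  by apply/funext => w; rewrite mul0r addr0.
have l0 j w : 0 <= lyapunov (state j w) by exact: lyapunov_ge0.
rewrite integral_affine//; last 2 first.
- by move=> w; exact: sqr_ge0.
- exact: mulr_ge0.
by rewrite integral_affine// mul0e !adde0.
Qed.

Lemma telescoped_descent K : F zs = 0 ->
  (\sum_(0 <= k < K) (alpha k * mu)%:E *
     \int[P]_w (enorm (F (bc_z (state k w))) ^+ 2)%:E <=
   ((1 + eta * gamma ^+ 2 * LF ^+ 2) * enorm (z0 - zs) ^+ 2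
     + C * sigma ^+ 2 * gamma ^+ 2 * \sum_(0 <= k < K) alpha k ^+ 2)%:E)%E.
Proof.
move=> Fzs.
have l0 j w : 0 <= lyapunov (state j w) by exact: lyapunov_ge0.
suff H : (\int[P]_w (lyapunov (state K w))%:E
   + \sum_(0 <= k < K) (alpha k * mu)%:E *
     \int[P]_w (enorm (F (bc_z (state k w))) ^+ 2)%:E <=
   ((1 + eta * gamma ^+ 2 * LF ^+ 2) * enorm (z0 - zs) ^+ 2
     + C * sigma ^+ 2 * gamma ^+ 2 * \sum_(0 <= k < K) alpha k ^+ 2)%:E)%E.
  apply: le_trans H; rewrite leeDr//.
  by apply: integral_ge0 => w _; rewrite lee_fin.
elim: K => [|K IH].
  rewrite !big_geq// mulr0 !addr0.
  rewrite [leLHS](integral_probability_cst P (lyapunov (BCSegState z0 z0 z0))).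
  by rewrite lee_fin lyapunov_init.
rewrite !big_nat_recr//= addeCA.
apply: (le_trans (leeD2l _ (expected_descent K))).
by rewrite addeCA addeA mulrDr [X in (_ <= X%:E)%E]addrA EFinD leeD2r.
Qed.

End bcseg_analysis.

(** * Convergence of the random iterate *)

Theorem theorem6p1
  (R : realType) (n : nat)
  (F : 'rV[R]_n -> 'rV[R]_n) (LF : R) (LF_ge0 : 0 <= LF)
  (F_lip : forall z z', enorm (F z - F z') <= LF * enorm (z - z'))
  (Sstar : set 'rV[R]_n) (Sstar_neq0 : Sstar !=set0)
  (Sstar_zer : Sstar `<=` zer F)
  (rho : R) (rho_gt : (- ((2 * LF)%:E^-1) < rho%:E)%E)
  (weak_minty : forall z zstar, Sstar zstar ->
    dotp (F z) (z - zstar) >= rho * enorm (F z) ^+ 2)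
  (* the oracle *)
  (dXi : measure_display) (Xi : measurableType dXi)
  (PXi : probability Xi R)
  (Fhat : 'rV[R]_n -> Xi -> 'rV[R]_n)
  (Fhat_meas : measurable_fun [set: 'rV[R]_n * Xi] (fun p => Fhat p.1 p.2))
  (sigmaF LFhat : R) (LFhat_gt0 : 0 < LFhat)
  (Fhat_unbiased : forall z (i : 'I_n),
    ('E_PXi[fun x => (Fhat z x 0 i)%R] = (F z 0 i)%R%:E)%E)
  (Fhat_var : forall z,
    ('E_PXi[fun x => (enorm (Fhat z x - F z) ^+ 2)%R] <= (sigmaF ^+ 2)%:E)%E)
  (Fhat_lip : forall z z',
    ('E_PXi[fun x => (enorm (Fhat z x - Fhat z' x) ^+ 2)%R]
       <= (LFhat ^+ 2 * enorm (z - z') ^+ 2)%:E)%E)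
  (* the step sizes *)
  (gamma : R) (gamma_gt : Num.max (- 2 * rho) 0 < gamma)
  (gamma_lt : (gamma%:E < LF%:E^-1)%E)
  (alpha : nat -> R) (alpha01 : forall k, 0 < alpha k < 1)
  (alpha_noninc : nonincreasing_seq alpha)
  (alpha_cvg0 : alpha @ \oo --> (0 : R))
  (alpha0_cond :
    2 * gamma * LFhat * Num.sqrt (alpha 0%N)
    + (1 + ((1 + gamma ^+ 2 * LF ^+ 2) / (1 - gamma ^+ 2 * LF ^+ 2)
             * (gamma ^+ 2 * LF ^+ 2))
           * (gamma ^+ 2 * LFhat ^+ 2)) * alpha 0%N
    <= 1 + 2 * rho / gamma)
  (* the algorithm *)
  (d : measure_display) (T : measurableType d) (P : probability T R)
  (xi xibar : nat -> {RV P >-> Xi})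
  (xi_law : forall k (A : set Xi), measurable A ->
    distribution P (xi k) A = PXi A)
  (xibar_law : forall k (A : set Xi), measurable A ->
    distribution P (xibar k) A = PXi A)
  (samples_indep :
    mutually_independent P (fun i w => samples xi xibar i w))
  (z0 : 'rV[R]_n) :
  let z k w :=
    bcseg_plus Fhat gamma alpha z0 (fun j => xi j w) (fun j => xibar j w) k in
  let eta := 2^-1 * ((1 + gamma ^+ 2 * LF ^+ 2) / (1 - gamma ^+ 2 * LF ^+ 2))
               * (gamma ^+ 2 * LF ^+ 2)
             + (gamma * LFhat * Num.sqrt (alpha 0%N))^-1 in
  let C := 1 + 2 * eta * ((gamma ^+ 2 * LFhat ^+ 2 + 1) + 2 * alpha 0%N) in
  let mu := gamma ^+ 2 * (1 - gamma ^+ 2 * LF ^+ 2) / 2 in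
  forall zstar, Sstar zstar ->
  forall (K : nat) (kstar : {RV P >-> nat}),
    (forall w, (kstar w <= K)%N) ->
    (forall k, (k <= K)%N ->
      P (kstar @^-1` [set k]) = (alpha k / \sum_(0 <= j < K.+1) alpha j)%:E) ->
    independent_of_family P kstar (fun i w => samples xi xibar i w) ->
  ('E_P[fun w => (enorm (F (z (kstar w) w)) ^+ 2)%R]
   <= (((1 + eta * gamma ^+ 2 * LF ^+ 2) * enorm (z0 - zstar) ^+ 2
        + C * sigmaF ^+ 2 * gamma ^+ 2 * \sum_(0 <= j < K.+1) alpha j ^+ 2)
       / (mu * \sum_(0 <= j < K.+1) alpha j))%R%:E)%E.
Proof.
move=> z eta C mu zstar Szs K kstar kstar_le kstar_law kstar_indep.
have g0 : 0 < gamma by move: gamma_gt; rewrite gt_max => /andP[].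
have gLF : gamma * LF < 1.
  have [LF0|LF0] := eqVneq LF 0; first by rewrite LF0 mulr0.
  have LFp : 0 < LF by rewrite lt_def LF0.
  move: gamma_lt; rewrite inver (negbTE LF0) lte_fin => gLF.
  by rewrite -(mulVf LF0) ltr_pM2r.
have c1 : gamma ^+ 2 * LF ^+ 2 < 1.
  by rewrite -exprMn expr_lt1// mulr_ge0// ltW.
have c0 : 0 <= gamma ^+ 2 * LF ^+ 2 by rewrite mulr_ge0 ?sqr_ge0.
have a0 k : 0 < alpha k by have /andP[] := alpha01 k.
have a01 k : 0 <= alpha k <= 1.
  by have /andP[h1 h2] := alpha01 k; rewrite !ltW.
have a_le k : alpha k <= alpha 0%N by exact: alpha_noninc.
set q := (1 + gamma ^+ 2 * LF ^+ 2) / (1 - gamma ^+ 2 * LF ^+ 2)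
         * (gamma ^+ 2 * LF ^+ 2) in alpha0_cond.
(* the minimizer of e + gamma^2 LFhat^2 alpha_0 / e *)
pose e := gamma * LFhat * Num.sqrt (alpha 0%N).
have e0 : 0 < e by rewrite /e mulr_gt0 ?sqrtr_gt0// mulr_gt0.
pose eta' := (q + e^-1) / 2.
have eta'E : 2 * eta' = q + e^-1 by rewrite /eta' mulrC divfK.
have eta'_le : eta' <= eta.
  have := invr_gt0 e; rewrite e0 => ie.
  rewrite /eta' /eta -/e (_ : 2^-1 * _ * _ = q / 2); last by rewrite /q; ring.
  lra.
have cond : e + alpha 0%N * (1 + 2 * eta' * (gamma ^+ 2 * LFhat ^+ 2))
            <= 1 + 2 * rho / gamma.
  apply: le_trans alpha0_cond.
  have ee : alpha 0%N * (gamma ^+ 2 * LFhat ^+ 2) = e ^+ 2.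
    by rewrite /e !exprMn sqr_sqrtr ?ltW//; ring.
  rewrite (_ : alpha 0%N * _ = alpha 0%N
    + q * (alpha 0%N * (gamma ^+ 2 * LFhat ^+ 2)) + e^-1 * (alpha 0%N * (gamma ^+ 2 * LFhat ^+ 2))).
    rewrite [e^-1 * _](_ : _ = e); last by rewrite ee expr2 mulKf// gt_eqF.
    by rewrite /e; lra.
  by rewrite eta'E; ring.
have Fhat_unbiased' z' (i : 'I_n) :
    (\int[PXi]_x (Fhat z' x 0 i)%:E = (F z' 0 i)%:E)%E.
  by have := Fhat_unbiased z' i; rewrite unlock.
have Fhat_var' z' :
    (\int[PXi]_x (enorm (Fhat z' x - F z') ^+ 2)%:E <= (sigmaF ^+ 2)%:E)%E.
  by have := Fhat_var z'; rewrite unlock.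
have Fhat_lip' z1 z2 : (\int[PXi]_x (enorm (Fhat z1 x - Fhat z2 x) ^+ 2)%:E
    <= (LFhat ^+ 2 * enorm (z1 - z2) ^+ 2)%:E)%E.
  by have := Fhat_lip z1 z2; rewrite unlock.
have Fzs : F zstar = 0 by exact: Sstar_zer.
have mF := measurable_oracle_mean Fhat_meas Fhat_unbiased'.
pose X i w := samples xi xibar i w.
have mX i : measurable_fun setT (X i).
  by case: i => k; exact: measurable_funP.
have H := telescoped_descent Fhat_meas Fhat_unbiased' Fhat_var' Fhat_lip' F_lip
  (fun z' => weak_minty z' zstar Szs) g0 c1 e0 eta'E a01 a_le cond
  xi_law xibar_law samples_indep z0 K.+1 Fzs.
have mz k : measurable_fun setT
    (fun w : family_space X => enorm (F (z k w)) ^+ 2).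
  have [_ _ m3] := measurable_bcseg_run Fhat_meas gamma (Om := family_space X)
    alpha z0 (xi := fun j w => xi j w) (xibar := fun j w => xibar j w) (k := k)
    (fun j _ => @measurable_fun_family_space T _ Xi _ X (inl j))
    (fun j _ => @measurable_fun_family_space T _ Xi _ X (inr j)).
  by apply: measurable_enorm_sqr; exact: (measurableT_comp mF m3).
rewrite unlock (expectation_random_index (X := X)
  (f := fun k w => enorm (F (z k w)) ^+ 2) mX kstar_indep kstar_le mz); last first.
  by move=> k w; exact: sqr_ge0.
set S := \sum_(0 <= j < K.+1) alpha j in kstar_law *.
have S0 : 0 < S.
  rewrite /S big_nat_recl//= ltr_pwDl// sumr_ge0// => j _; exact/ltW.
have mu0 : 0 < mu by rewrite divr_gt0// mulr_gt0 ?exprn_gt0// subr_gt0.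
have eta'0 : 0 <= eta' by rewrite ltW// (eta_gt0 c1 e0 eta'E).
have muS0 : 0 < mu * S := mulr_gt0 mu0 S0.
rewrite [leRHS]EFinM lee_pdivlMr//.
set b := fun k => (\int[P]_w (enorm (F (z k w)) ^+ 2)%:E)%E.
have b0 k : (0 <= b k)%E.
  by apply: integral_ge0 => w _; rewrite lee_fin sqr_ge0.
have -> : (\sum_(0 <= k < K.+1) P (kstar @^-1` [set k]) * b k)%E =
    (\sum_(0 <= k < K.+1) (alpha k / S)%:E * b k)%E.
  by apply: eq_big_nat => k /andP[_ kK]; rewrite kstar_law.
rewrite ge0_sume_distrl; last first.
  by move=> k _; rewrite mule_ge0// lee_fin divr_ge0// ltW.
rewrite (_ : (\sum_(0 <= k < K.+1) _)%E =
    (\sum_(0 <= k < K.+1) (alpha k * mu)%:E * b k)%E); last first.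
  apply: eq_bigr => k _; rewrite muleAC -EFinM; congr (_%:E * _)%E.
  by field; rewrite gt_eqF.
apply: (le_trans H); rewrite lee_fin lerD//.
  rewrite ler_wpM2r ?sqr_ge0// lerD2l ler_wpM2r ?sqr_ge0//.
  by rewrite ler_wpM2r ?sqr_ge0.
have sum0 : 0 <= \sum_(0 <= k < K.+1) alpha k ^+ 2.
  by rewrite sumr_ge0// => k _; exact: sqr_ge0.
rewrite ler_wpM2r// ler_wpM2r ?sqr_ge0// ler_wpM2r ?sqr_ge0// lerD2l.
rewrite ler_wpM2r//; last by rewrite ler_wpM2l.
by rewrite addr_ge0 ?mulr_ge0 ?addr_ge0 ?mulr_ge0 ?sqr_ge0// ltW.
Qed.
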